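(* For all integers $d \geq 3$ and $n \geq 2$, consider the polynomial map $f_{d,n} \colon \mathbb{C}^2 \to \mathbb{C}^2$ given by $$f_{d,n}(x,y) := (x,\; y^d - d x^n y).$$ Then, for all integers $d \geq 3$ and $m, n \geq 2$, the maps $f_{d,n}$ and $f_{d,m}$ are equivalent if and only if $m = n$. It follows that, for every $d \geq 3$, there exist infinitely many different equivalence classes of proper polynomial maps $\mathbb{C}^2 \to \mathbb{C}^2$ of topological degree $d$.
   Context: A dominant polynomial map $f \colon \mathbb{C}^2 \to \mathbb{C}^2$ is proper if it is closed and $f^{-1}(p)$ is compact for every $p \in \mathbb{C}^2$; equivalently, if the preimage of every compact set is compact. Its topological degree is the number of preimages of a general point. $\mathrm{Aut}(\mathbb{C}^2)$ denotes the group of polynomial automorphisms of $\mathbb{C}^2$. Two proper polynomial maps $f_1, f_2 \colon \mathbb{C}^2 \to \mathbb{C}^2$ are equivalent if there exist $\Phi_1, \Phi_2 \in \mathrm{Aut}(\mathbb{C}^2)$ such that $f_2 = \Phi_2 \circ f_1 \circ \Phi_1$. *)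

(* Defs.v *)
From HB Require Import structures.
From mathcomp Require Import all_boot all_order all_algebra.
From mathcomp Require Import complex.
From mathcomp Require Import all_classical all_reals all_analysis.

Set Implicit Arguments.
Unset Strict Implicit.
Unset Printing Implicit Defensive.

Import Order.TTheory GRing.Theory Num.Theory.
Import numFieldNormedType.Exports.

Local Open Scope classical_set_scope.
Local Open Scope ring_scope.

(* Typed as a structure so that C and C * C carry the topology that
   numFieldNormedType puts on every numFieldType, i.e. that of the modulus. *)
Definition Cplx (R : realType) : numClosedFieldType := R[i].

Section PolynomialMaps.
Variable C : numClosedFieldType.
Implicit Types f g : C * C -> C * C.

Definition eval2 (p : {poly {poly C}}) (z : C * C) : C := p.[z.1, z.2].

Definition polynomial_map f :=
  exists p q : {poly {poly C}}, forall z, f z = (eval2 p z, eval2 q z).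

(* The image is Zariski dense. *)
Definition dominant f :=
  forall p : {poly {poly C}}, (forall z, eval2 p (f z) = 0) -> p = 0.

Definition proper_polynomial_map f :=
  [/\ polynomial_map f, dominant f,
      forall A, closed A -> closed (f @` A) &
      forall p, compact (f @^-1` [set p])].

(* "General point": any point outside the zero locus of some nonzero h. *)
Definition has_topological_degree f (d : nat) :=
  exists2 h : {poly {poly C}}, h != 0 &
    forall p, eval2 h p != 0 -> (f @^-1` [set p] #= `I_d)%card.

Definition polynomial_automorphism f :=
  polynomial_map f /\ exists2 g, polynomial_map g & cancel f g /\ cancel g f.

Definition equivalent_maps f1 f2 :=
  [/\ proper_polynomial_map f1, proper_polynomial_map f2 &
      exists Phi1 Phi2, [/\ polynomial_automorphism Phi1,
        polynomial_automorphism Phi2 & f2 = Phi2 \o f1 \o Phi1]].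

Definition equivalence_class f := [set g | equivalent_maps f g].

Definition proper_classes (d : nat) : set (set (C * C -> C * C)) :=
  [set equivalence_class f |
    f in [set f | proper_polynomial_map f /\ has_topological_degree f d]].

Definition fdn (d n : nat) (z : C * C) : C * C :=
  (z.1, z.2 ^+ d - d%:R * z.1 ^+ n * z.2).

End PolynomialMaps.

Arguments fdn {C}.
Arguments proper_classes C d : clear implicits.

(* Main.v *)
Require Import Defs.
From mathcomp Require Import all_boot all_order all_algebra separable.
From mathcomp Require Import all_classical all_reals all_analysis.
From mathcomp Require Import ring zify.

(* Up to a constant the Jacobian of f_{d,n} is G_n = y^(d-1) - x^n, and the
   Jacobian of an automorphism is a nonzero constant; so an equivalence
   f_m = Phi2 o f_n o Phi1 gives G_m = c (G_n o Phi1).  By the chain rule Phi1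
   carries the gradient ideal (x^(n-1), y^(d-2)) into (x^(m-1), y^(d-2)); in
   particular Phi1 fixes the origin.  If n < m, the monomial x^(m-2) y^(d-3),
   read through the inverse of Phi1, is a product of m + d - 5 >= n + d - 4
   elements of the maximal ideal (x, y), hence lies in (x^(n-1), y^(d-2)).
   Pulling back along Phi1, x^(m-2) y^(d-3) lies in (x^(m-1), y^(d-2)), which is
   absurd.

   f_{d,n} is closed because the fibre over (a, b) is cut out by a monic
   polynomial in y: if y stays e-far from all its roots, the product of the
   distances bounds this polynomial from below by a multiple of 1 + |y|, whereas
   its coefficients move little when (a, b) does.  *)

Set Implicit Arguments.
Unset Strict Implicit.
Unset Printing Implicit Defensive.

Import Order.TTheory GRing.Theory Num.Theory.
Import numFieldNormedType.Exports.

Local Open Scope classical_set_scope.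
Local Open Scope ring_scope.

(** * Polynomials in two variables: derivatives, chain rule, Jacobians *)

Section BivariateCalculus.
Variable C : numClosedFieldType.
Implicit Types (p q u v w s t : {poly {poly C}}) (z : C * C) (f g : C * C -> C * C).

Definition dx p : {poly {poly C}} := p^`().
(** The outer indeterminate ['X] is x and the inner one ['X%:P] is y, so the y-derivative acts on
    coefficients. *)
Definition dy p : {poly {poly C}} := map_poly (@deriv C) p.

Lemma dxM p q : dx (p * q) = dx p * q + p * dx q.
Proof. exact: derivM. Qed.

Lemma coef_dy p i : (dy p)`_i = (p`_i)^`().
Proof. by rewrite coef_map_id0 ?deriv0. Qed.

Lemma dyM p q : dy (p * q) = dy p * q + p * dy q.
Proof.
apply/polyP => i; rewrite coefD coef_dy !coefM -big_split /= raddf_sum /=.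
by apply: eq_bigr => j _; rewrite derivM !coef_dy.
Qed.

Lemma dyD p q : dy (p + q) = dy p + dy q.
Proof. by apply/polyP => i; rewrite coefD !coef_dy coefD derivD. Qed.

Lemma dyC (c : {poly C}) : dy c%:P = (c^`())%:P.
Proof. by apply/polyP => i; rewrite coef_dy !coefC; case: eqP; rewrite ?deriv0. Qed.

Lemma dy_X : dy 'X = 0.
Proof.
by apply/polyP => i; rewrite coef_dy coefX coef0; case: eqP; rewrite ?deriv0 ?derivC.
Qed.

Lemma eval2D p q z : eval2 (p + q) z = eval2 p z + eval2 q z.
Proof. by rewrite /eval2 !hornerD. Qed.

Lemma eval2N p z : eval2 (- p) z = - eval2 p z.
Proof. by rewrite /eval2 !hornerN. Qed.

Lemma eval2M p q z : eval2 (p * q) z = eval2 p z * eval2 q z.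
Proof. by rewrite /eval2 !hornerM. Qed.

Lemma eval2_exp p k z : eval2 (p ^+ k) z = eval2 p z ^+ k.
Proof. by rewrite /eval2 !horner_exp. Qed.

Lemma eval2C (c : C) z : eval2 c%:P%:P z = c.
Proof. by rewrite /eval2 !hornerC. Qed.

Lemma eval2X z : eval2 'X z = z.1.
Proof. by rewrite /eval2 hornerX hornerC. Qed.

Lemma eval2Y z : eval2 'X%:P z = z.2.
Proof. by rewrite /eval2 hornerC hornerX. Qed.

Definition eval2E := (eval2D, eval2N, eval2M, eval2_exp, eval2C, eval2X, eval2Y).

(** The first [size p] values of [g] would be too many roots for a nonzero [p]. *)
Lemma horner_eq0_on_nat (A : idomainType) (g : nat -> A) (p : {poly A}) :
  injective g -> (forall k, p.[g k] = 0) -> p = 0.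
Proof.
move=> g_inj p0; apply: contraTeq isT => p_neq0.
have := @max_poly_roots A p (map g (iota 0 (size p))) p_neq0.
rewrite size_map size_iota ltnn; apply.
  by apply/allP => _ /mapP[k _ ->]; apply/rootP.
by rewrite map_inj_uniq ?iota_uniq.
Qed.

(** Roots are counted twice on the grid of naturals: in x over [{poly C}], then in y over [C]. *)
Lemma eval2_eq0 p : (forall z, eval2 p z = 0) -> p = 0.
Proof.
have natI : injective (fun k => k%:R : C) by exact: mulrIn (oner_neq0 C).
move=> p0; apply: (@horner_eq0_on_nat _ (fun k => (k%:R)%:P)).
  by move=> j k /polyC_inj /natI.
move=> j; apply: (@horner_eq0_on_nat _ (fun k => k%:R)) => // k.
exact: (p0 (j%:R, k%:R)).
Qed.

Lemma eval2_inj p q : (forall z, eval2 p z = eval2 q z) -> p = q.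
Proof.
move=> pq; apply/eqP; rewrite -subr_eq0; apply/eqP/eval2_eq0 => z.
by rewrite !eval2E pq subrr.
Qed.

Lemma poly2_ind (K : {poly {poly C}} -> Prop) :
  (forall c : C, K c%:P%:P) -> K 'X -> K 'X%:P ->
  (forall p q, K p -> K q -> K (p + q)) ->
  (forall p q, K p -> K q -> K (p * q)) -> forall p, K p.
Proof.
move=> KC KX KY KD KM; apply: poly_ind => [|p c Kp]; first by rewrite -!polyC0.
apply: (KD _ _ (KM _ _ Kp KX)); elim/poly_ind: c => [|c k Kc]; first exact: KC.
by rewrite polyCD polyCM; apply: (KD _ _ (KM _ _ Kc KY)).
Qed.

(** One induction on [p] builds the substituted polynomial together with both chain rules; Leibniz
    settles products. *)
Lemma comp2_chain_exists p u v : exists w,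
  [/\ forall z, eval2 w z = eval2 p (eval2 u z, eval2 v z),
      forall z, eval2 (dx w) z =
        eval2 (dx p) (eval2 u z, eval2 v z) * eval2 (dx u) z +
        eval2 (dy p) (eval2 u z, eval2 v z) * eval2 (dx v) z &
      forall z, eval2 (dy w) z =
        eval2 (dx p) (eval2 u z, eval2 v z) * eval2 (dy u) z +
        eval2 (dy p) (eval2 u z, eval2 v z) * eval2 (dy v) z].
Proof.
elim/poly2_ind: p => [c|||p q [w [w1 w2 w3]] [w' [w'1 w'2 w'3]]
  |p q [w [w1 w2 w3]] [w' [w'1 w'2 w'3]]].
- exists c%:P%:P; split=> z.
  + by rewrite !eval2C.
  + by rewrite /dx !derivC -!polyC0 dyC derivC !eval2C !mul0r addr0.
  + by rewrite /dx !derivC -!polyC0 dyC derivC !eval2C !mul0r addr0.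
- exists u; split=> z; first by rewrite eval2X.
  + by rewrite {2}/dx derivX dy_X -!polyC0 -!polyC1 !eval2C mul1r mul0r addr0.
  + by rewrite /dx derivX dy_X -!polyC0 -!polyC1 !eval2C mul1r mul0r addr0.
- exists v; split=> z; first by rewrite eval2Y.
  + by rewrite {2}/dx derivC dyC derivX -!polyC0 -!polyC1 !eval2C mul1r mul0r add0r.
  + by rewrite /dx derivC dyC derivX -!polyC0 -!polyC1 !eval2C mul1r mul0r add0r.
- exists (w + w'); split=> z; first by rewrite !eval2D w1 w'1.
  + by rewrite /dx !derivD !dyD !eval2D -!/(dx _) w2 w'2; ring.
  + by rewrite /dx !derivD !dyD !eval2D -!/(dx _) w3 w'3; ring.
- exists (w * w'); split=> z; first by rewrite !eval2M w1 w'1.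
  + by rewrite !dxM !dyM !eval2E w1 w2 w'1 w'2; ring.
  + by rewrite !dxM !dyM !eval2E w1 w3 w'1 w'3; ring.
Qed.

Lemma comp2_exists p u v :
  exists w, forall z, eval2 w z = eval2 p (eval2 u z, eval2 v z).
Proof. by have [w []] := comp2_chain_exists p u v; exists w. Qed.

Lemma chain_rule p u v w :
  (forall z, eval2 w z = eval2 p (eval2 u z, eval2 v z)) -> forall z,
  eval2 (dx w) z = eval2 (dx p) (eval2 u z, eval2 v z) * eval2 (dx u) z +
                   eval2 (dy p) (eval2 u z, eval2 v z) * eval2 (dx v) z /\
  eval2 (dy w) z = eval2 (dx p) (eval2 u z, eval2 v z) * eval2 (dy u) z +
                   eval2 (dy p) (eval2 u z, eval2 v z) * eval2 (dy v) z.
Proof.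
move=> wE; have [w' [w'E dxw' dyw']] := comp2_chain_exists p u v.
by have -> : w = w' by apply: eval2_inj => z; rewrite wE w'E.
Qed.

Definition jac p q := dx p * dy q - dy p * dx q.

Lemma jac_comp p q u v p' q' :
  (forall z, eval2 p' z = eval2 p (eval2 u z, eval2 v z)) ->
  (forall z, eval2 q' z = eval2 q (eval2 u z, eval2 v z)) ->
  forall z, eval2 (jac p' q') z =
            eval2 (jac p q) (eval2 u z, eval2 v z) * eval2 (jac u v) z.
Proof.
move=> /chain_rule p'E /chain_rule q'E z.
have [px py] := p'E z; have [qx qy] := q'E z.
by rewrite !eval2E px py qx qy; ring.
Qed.

Lemma jacXY : jac 'X 'X%:P = 1.
Proof. by rewrite /jac /dx derivX derivC dyC derivX mulr0 subr0 mulr1. Qed.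

(** Degrees add over a domain. The general domain allows one use over [{poly C}] and a second over
    [C]. *)
Lemma poly_mul_eq1 (A : idomainType) (p q : {poly A}) :
  p * q = 1 -> exists2 c, p = c%:P & exists2 e, q = e%:P & c * e = 1.
Proof.
move=> pq1; have : size (p * q) = 1%N by rewrite pq1 size_poly1.
have [p0 q0] : p != 0 /\ q != 0.
  by apply/andP; rewrite -negb_or -mulf_eq0 pq1 oner_neq0.
rewrite size_mul // => sz.
have := size_poly_eq0 p; have := size_poly_eq0 q.
rewrite (negPf p0) (negPf q0) => sq sp.
have {sz sq} [sp1 sq1] : (size p <= 1)%N /\ (size q <= 1)%N.
  by move: (size p) (size q) sz sp sq => [|[|a]] [|[|b]]; rewrite ?addnS.
exists p`_0; first exact: size1_polyC.
exists q`_0; first exact: size1_polyC.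
by rewrite -coef0M pq1 coef1.
Qed.

(** By the chain rule the Jacobian times that of the left inverse, composed with the map, is 1; so
    it is a unit of C[x, y]. *)
Lemma jac_inverse_const p q p' q' :
  (forall z, (eval2 p' (eval2 p z, eval2 q z), eval2 q' (eval2 p z, eval2 q z)) = z) ->
  exists2 c : C, c != 0 & forall z, eval2 (jac p q) z = c.
Proof.
move=> K; have [w wE] := comp2_exists (jac p' q') p q.
have : jac p q * w = 1.
  apply: eval2_inj => z; rewrite eval2M wE mulrC -jacXY.
  have [K1 K2] : (forall z, eval2 'X z = eval2 p' (eval2 p z, eval2 q z)) /\
      forall z, eval2 'X%:P z = eval2 q' (eval2 p z, eval2 q z).
    by split=> y; rewrite ?eval2X ?eval2Y -{1}[y]K.
  by rewrite (jac_comp K1 K2).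
move=> /poly_mul_eq1[c cE [e _ /poly_mul_eq1[k kE [l _ kl]]]].
exists k; last by move=> z; rewrite cE kE eval2C.
by apply: contra_eq_neq kl => ->; rewrite mul0r eq_sym oner_neq0.
Qed.

Lemma automorphism_jac_const f : polynomial_automorphism f ->
  exists p q, (forall z, f z = (eval2 p z, eval2 q z)) /\
    exists2 c : C, c != 0 & forall z, eval2 (jac p q) z = c.
Proof.
move=> [[p [q fE]] [g [p' [q' gE]] [fK _]]]; exists p, q; split=> //.
by apply: (@jac_inverse_const _ _ p' q') => z; rewrite -fE -gE fK.
Qed.

End BivariateCalculus.

(** * Rigidity of the exponent n under equivalence *)

Section NonEquivalence.
Variable C : numClosedFieldType.
Implicit Types (p q u v w : {poly {poly C}}) (z : C * C) (f g : C * C -> C * C).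

Lemma eval2_origin p : eval2 p (0, 0) = 0 ->
  exists s t, p = 'X * s + 'X%:P * t.
Proof.
elim/poly_ind: p => [|p c _]; first by exists 0, 0; rewrite !mulr0 addr0.
elim/poly_ind: c => [|c k _]; first by exists p, 0; rewrite mulr0 !addr0 mulrC.
rewrite polyCD polyCM !eval2E !(mulr0, add0r) => ->.
by exists p, c%:P; rewrite !polyC0 addr0 mulrC [c%:P * _]mulrC.
Qed.

(* Pigeonhole: a monomial of degree [k >= a + b - 1] in [x, y] is divisible by
   [x ^+ a] or by [y ^+ b]. *)
Lemma prod_mem_expX_expY (A : comNzRingType) (x y : A) (zs : seq A) (a b : nat) :
  (forall e, e \in zs -> exists s t, e = x * s + y * t) ->
  (a + b <= (size zs).+1)%N ->
  exists s t, \prod_(e <- zs) e = x ^+ a * s + y ^+ b * t.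
Proof.
elim: zs a b => [|e zs IH] [|a] [|b] zsP //= ab.
- by exists 1, 0; rewrite expr0 mul1r mulr0 addr0 big_nil.
- by exists 1, 0; rewrite expr0 mul1r mulr0 addr0 big_nil.
- by exists 0, 1; rewrite expr0 mul1r mulr0 add0r big_nil.
- by move: ab; rewrite addnS addSn.
- by exists (\prod_(j <- e :: zs) j), 0; rewrite expr0 mul1r mulr0 addr0.
- by exists (\prod_(j <- e :: zs) j), 0; rewrite expr0 mul1r mulr0 addr0.
- by exists 0, (\prod_(j <- e :: zs) j); rewrite expr0 mul1r mulr0 add0r.
- have zsP' i : i \in zs -> exists s t, i = x * s + y * t.
    by move=> izs; apply: zsP; rewrite inE izs orbT.
  have [s0 [t0 eE]] := zsP e (mem_head _ _).
  (* The x-part of [e] already supplies one factor x and its y-part one factor y, so each part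
     lowers one exponent. *)
  have [s [t E1]] := IH a b.+1 zsP' ltac:(lia).
  have [s' [t' E2]] := IH a.+1 b zsP' ltac:(lia).
  exists (s0 * s + y * t0 * s'), (x * s0 * t + t0 * t').
  rewrite big_cons eE mulrDl {1}E1 E2 !exprS; ring.
Qed.

(** The coefficient of x^a y^b is 1 on the left and 0 on the right. *)
Lemma expX_expY_notin (a b : nat) (s t : {poly {poly C}}) :
  'X ^+ a * ('X%:P) ^+ b <> 'X ^+ a.+1 * s + ('X%:P) ^+ b.+1 * t :> {poly {poly C}}.
Proof.
move=> /(congr1 (fun p => p`_a`_b)) /eqP.
rewrite coefXnM ltnn subnn -!rmorphXn /= coefC eqxx coefXn eqxx.
by rewrite coefD coefXnM ltnSn add0r coefCM coefXnM ltnSn oner_eq0.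
Qed.

Definition fdn2 d n : {poly {poly C}} :=
  'X%:P ^+ d + (- d%:R)%:P%:P * 'X ^+ n * 'X%:P.

Lemma fdnE d n z : fdn d n z = (eval2 'X z, eval2 (fdn2 d n) z).
Proof. by rewrite /fdn !eval2E !mulNr. Qed.

Lemma dy_expX n : dy ('X ^+ n : {poly {poly C}}) = 0.
Proof.
apply/polyP => i; rewrite coef_dy coefXn coef0.
by case: eqP => _; rewrite ?deriv0 // derivC.
Qed.

Lemma dy_expY n : dy ('X%:P ^+ n : {poly {poly C}}) = n%:R%:P%:P * 'X%:P ^+ n.-1.
Proof.
rewrite -!rmorphXn /= dyC derivXn -polyCM -mulr_natl.
by rewrite polyC_natr.
Qed.

Lemma dx_expX n : dx ('X ^+ n : {poly {poly C}}) = n%:R%:P%:P * 'X ^+ n.-1.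
Proof. by rewrite /dx derivXn -mulr_natl !polyC_natr. Qed.

Lemma dx_expY n : dx ('X%:P ^+ n : {poly {poly C}}) = 0.
Proof. by rewrite -rmorphXn /dx derivC. Qed.

Lemma jac_fdn d n z :
  eval2 (jac 'X (fdn2 d.+1 n)) z = d.+1%:R * (z.2 ^+ d - z.1 ^+ n).
Proof.
rewrite /jac dy_X mul0r subr0 {1}/dx derivX mul1r /fdn2 dyD !dyM dy_expY dy_expX.
by rewrite !dyC derivC derivX !(mul0r, mulr0, add0r, addr0, mulr1) !eval2E /=; ring.
Qed.

(** Jacobians multiply along the composite, and those of [f] and [g] are nonzero constants. *)
Lemma critical_curve_transfer d m n f g :
  polynomial_automorphism f -> polynomial_automorphism g ->
  fdn d.+1 m = g \o fdn d.+1 n \o f ->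
  exists2 c : C, c != 0 & forall z,
    z.2 ^+ d - z.1 ^+ m = c * ((f z).2 ^+ d - (f z).1 ^+ n).
Proof.
move=> /automorphism_jac_const[P [Q [fE [c c0 cE]]]].
move=> /automorphism_jac_const[p [q [gE [e e0 eE]]]] fgE.
have [w wE] := comp2_exists (fdn2 d.+1 n) P Q.
have PE z : eval2 P z = eval2 'X (eval2 P z, eval2 Q z) by rewrite eval2X.
have E z : (eval2 'X z, eval2 (fdn2 d.+1 m) z) =
    (eval2 p (eval2 P z, eval2 w z), eval2 q (eval2 P z, eval2 w z)).
  by rewrite -fdnE fgE /= fE fdnE gE wE -PE.
exists (e * c) => [|z]; first by rewrite mulf_neq0.
have := @jac_comp _ p q P w 'X (fdn2 d.+1 m) (fun z => congr1 fst (E z))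
  (fun z => congr1 snd (E z)) z.
rewrite eE (@jac_comp _ _ _ P Q _ _ PE wE) cE !jac_fdn fE /=.
move=> jacE; apply: (@mulfI _ d.+1%:R); first by rewrite pnatr_eq0.
by rewrite jacE; ring.
Qed.

(** Up to a constant, the Jacobian of [fdn i.+1 j]. *)
Definition cusp (c : C) i j : {poly {poly C}} :=
  c%:P%:P * ('X%:P ^+ i + (-1)%:P%:P * 'X ^+ j).

Lemma eval2_cusp c i j z : eval2 (cusp c i j) z = c * (z.2 ^+ i - z.1 ^+ j).
Proof. by rewrite !eval2E mulN1r. Qed.

Lemma eval2_dx_cusp c i j z : eval2 (dx (cusp c i j)) z = - (c * j%:R * z.1 ^+ j.-1).
Proof.
rewrite dxM /dx derivD derivM !derivC -!/(dx _) dx_expX dx_expY.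
by rewrite !(mul0r, add0r) !eval2E; ring.
Qed.

Lemma eval2_dy_cusp c i j z : eval2 (dy (cusp c i j)) z = c * i%:R * z.2 ^+ i.-1.
Proof.
rewrite dyM dyD dyM !dyC dy_expX dy_expY !derivC !polyC0.
by rewrite !(mul0r, mulr0, add0r, addr0) !eval2E; ring.
Qed.

(** Here d = b + 3, m = k + 2 and n = l + 2, so the gradient ideals are (x^(k+1), y^(b+1)) and
    (x^(l+1), y^(b+1)), and the decisive monomial is x^k y^b. *)
Lemma exponent_le (b k l : nat) f g :
  polynomial_automorphism f -> polynomial_automorphism g ->
  fdn b.+3 k.+2 = g \o fdn b.+3 l.+2 \o f -> (k <= l)%N.
Proof.
move=> fA gA /(critical_curve_transfer fA gA)[c c0 fE] {g gA}.
case: fA => [[P [Q PQ]] [g [A [B AB]] [fK gK]]].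
(* The relation is read through the inverse [g] of [f]; its gradient at [f z] then involves powers
   of [P] and [Q] on one side, of x and y on the other. *)
have gE z : eval2 (cusp c b.+2 l.+2) z =
    eval2 (cusp 1 b.+2 k.+2) (eval2 A z, eval2 B z).
  by rewrite !eval2_cusp mul1r -AB fE gK.
have fAB z : (eval2 A (f z), eval2 B (f z)) = z by rewrite -AB fK.
have natC0 i : i.+1%:R != 0 :> C by rewrite pnatr_eq0.
have compf p : exists w, forall z, eval2 w z = eval2 p (f z).
  by have [w wE] := comp2_exists p P Q; exists w => z; rewrite PQ.
have grad z := chain_rule gE (f z).
have [s [t PE]] : exists s t, P ^+ l.+1 = 'X ^+ k.+1 * s + 'X%:P ^+ b.+1 * t.
  have [Ax AxE] := compf (dx A); have [Bx BxE] := compf (dx B).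
  (* The x-component of the chain rule, divided by - c (l + 2). *)
  exists (((c * l.+2%:R)^-1 * k.+2%:R)%:P%:P * Ax),
         ((- (c * l.+2%:R)^-1 * b.+2%:R)%:P%:P * Bx).
  apply: eval2_inj => z; have [+ _] := grad z.
  rewrite fAB !eval2_dx_cusp !eval2_dy_cusp !eval2E AxE BxE PQ /= !mul1r.
  move=> /(canRL (@opprK _)) /(canRL (mulKf (mulf_neq0 c0 (natC0 _)))) ->.
  by ring.
have [s' [t' QE]] : exists s t, Q ^+ b.+1 = 'X ^+ k.+1 * s + 'X%:P ^+ b.+1 * t.
  have [Ay AyE] := compf (dy A); have [By ByE] := compf (dy B).
  exists ((- (c * b.+2%:R)^-1 * k.+2%:R)%:P%:P * Ay),
         (((c * b.+2%:R)^-1 * b.+2%:R)%:P%:P * By).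
  apply: eval2_inj => z; have [_ +] := grad z.
  rewrite fAB !eval2_dx_cusp !eval2_dy_cusp !eval2E AyE ByE PQ /= !mul1r.
  move=> /(canRL (mulKf (mulf_neq0 c0 (natC0 _)))) ->.
  by ring.
have f0 : f (0, 0) = (0, 0).
  have at0 p i u v : p ^+ i.+1 = 'X ^+ k.+1 * u + 'X%:P ^+ b.+1 * v ->
      eval2 p (0, 0) = 0.
    move=> /(congr1 (fun r => eval2 r (0, 0))); rewrite !eval2E /= !expr0n /=.
    by rewrite !mul0r addr0 => /eqP; rewrite expf_eq0 => /eqP.
  by rewrite PQ (at0 _ _ _ _ PE) (at0 _ _ _ _ QE).
have [A0 B0] : eval2 A (0, 0) = 0 /\ eval2 B (0, 0) = 0.
  by have := fAB (0, 0); rewrite f0 => -[].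
rewrite leqNgt; apply/negP => ltlk.
(* [A] and [B] vanish at the origin. If l < k, these k + b factors suffice for the exponents l + 1
   and b + 1. *)
have in_max : forall e, e \in nseq k A ++ nseq b B ->
    exists u v, e = 'X * u + 'X%:P * v.
  by move=> e; rewrite mem_cat !mem_nseq => /orP[] /andP[_ /eqP ->];
    exact: eval2_origin.
have [|u [v]] := @prod_mem_expX_expY _ 'X 'X%:P _ l.+1 b.+1 in_max.
  by rewrite size_cat !size_nseq; lia.
rewrite big_cat /= !big_nseq -!Monoid.iteropE /=.
rewrite -[iterop k _ _ _]/(A ^+ k) -[iterop b _ _ _]/(B ^+ b) => ABE.
have [[u' u'E] [v' v'E]] := (compf u, compf v).
(* At [f z], [A] and [B] become x and y, while [PE] and [QE] expand the powers of [P] and [Q]. *)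
apply: (@expX_expY_notin k b (s * u' + s' * v') (t * u' + t' * v')).
apply: eval2_inj => z; have /= Az := congr1 fst (fAB z).
have /= Bz := congr1 snd (fAB z).
have := congr1 (fun r => eval2 r (f z)) ABE.
have := congr1 (fun r => eval2 r z) QE; have := congr1 (fun r => eval2 r z) PE.
rewrite !eval2E u'E v'E Az Bz PQ /= => -> -> ->.
by ring.
Qed.

End NonEquivalence.

(** * Fibres, topological degree and properness of f_{d,n} *)

Section FdnProper.
Variable C : numClosedFieldType.
Implicit Types (a b y : C) (z : C * C) (A : set (C * C)).

(** Its roots are the second coordinates of the preimages of [z], whose first coordinate is
    [z.1]. *)
Definition fiber_poly d n z : {poly C} :=
  'X^d - (d%:R * z.1 ^+ n) *: 'X - z.2%:P.

Lemma fiber_poly_horner d n z y :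
  (fiber_poly d n z).[y] = y ^+ d - d%:R * z.1 ^+ n * y - z.2.
Proof. by rewrite !hornerE. Qed.

(** For d at least 2 the term y^d outweighs the linear one, so the polynomial is monic of degree
    d. *)
Lemma fiber_poly_roots d n z : (2 <= d)%N ->
  exists rs : seq C,
    fiber_poly d n z = \prod_(r <- rs) ('X - r%:P) /\ size rs = d.
Proof.
move=> d2; have szl : (size (- ((d%:R * z.1 ^+ n) *: 'X) - z.2%:P : {poly C})%R
    < size ('X^d : {poly C})%R)%N.
  rewrite size_polyXn ltnS (leq_trans (size_polyD _ _)) // geq_max !size_polyN.
  rewrite (leq_trans (size_scale_leq _ _)) ?size_polyX //.
  by rewrite (leq_trans (size_polyC_leq1 _)) // ltnW.
have [rs rsE] := closed_field_poly_normal (fiber_poly d n z).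
have szp : size (fiber_poly d n z) = d.+1.
  by rewrite /fiber_poly -addrA size_polyDl // size_polyXn.
have lc1 : lead_coef (fiber_poly d n z) = 1.
  by rewrite /fiber_poly -addrA lead_coefDl // lead_coefXn.
exists rs; move: rsE; rewrite lc1 scale1r => rsE; split=> //.
by apply/succn_inj; rewrite -szp rsE size_prod_XsubC.
Qed.

Lemma fdn_fiber d n z (rs : seq C) :
  fiber_poly d n z = \prod_(r <- rs) ('X - r%:P) ->
  fdn d n @^-1` [set z] = [set` [seq (z.1, r) | r <- rs]].
Proof.
move=> rsE; case: z rsE => a b rsE; apply/seteqP; split=> -[x y] /=.
  case=> -> yb; apply/mapP; exists y => //.
  by rewrite -root_prod_XsubC -rsE rootE fiber_poly_horner /= yb subrr.
move=> /mapP[r rrs [-> ->]]; congr pair; apply/eqP; rewrite -subr_eq0.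
by rewrite -(fiber_poly_horner d n (a, b)) rsE -rootE root_prod_XsubC.
Qed.

Lemma card_eq_uniq_seq (T : eqType) (s : seq T) :
  uniq s -> ([set` s] #= `I_(size s))%card.
Proof.
move=> us; apply/card_set_bijP; exists (fun x => index x s); split.
- by move=> x /=; rewrite index_mem.
- move=> x y /set_mem /= xs /set_mem /= ys eidx.
  by rewrite -(nth_index x xs) eidx nth_index.
- move=> i /= ilt; have [x0 _] : exists x : T, x \in s.
    by case: s us ilt => // x s _ _; exists x; rewrite mem_head.
  by exists (nth x0 s i); rewrite /= ?mem_nth ?index_uniq.
Qed.

Lemma fdn_surjective d n z : (2 <= d)%N -> exists w, fdn d n w = z.
Proof.
move=> d2; have [rs [rsE szrs]] := fiber_poly_roots n z d2.
case: rs rsE szrs => [_ d0|r rs rsE _]; first by move: d2; rewrite -d0.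
exists (z.1, r); have : (fdn d n @^-1` [set z]) (z.1, r).
  by rewrite (fdn_fiber rsE) /= mem_head.
by [].
Qed.

Lemma fdn_polynomial_map d n : polynomial_map (@fdn C d n).
Proof. by exists 'X, (fdn2 C d n) => z; exact: fdnE. Qed.

Lemma fdn_dominant d n : (2 <= d)%N -> dominant (@fdn C d n).
Proof.
move=> d2 p p0; apply: eval2_eq0 => z.
by have [w <-] := fdn_surjective n z d2.
Qed.

Lemma fdn_fiber_compact d n z : (2 <= d)%N -> compact (@fdn C d n @^-1` [set z]).
Proof.
move=> d2; have [rs [rsE _]] := fiber_poly_roots n z d2.
by rewrite (fdn_fiber rsE); apply: finite_compact; exact: finite_seq.
Qed.

(** The fibre has d points once its polynomial is separable; a multiple root forces [z] onto the
    branch curve. *)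
Lemma fdn_topological_degree d n : (2 <= d)%N -> (0 < n)%N ->
  has_topological_degree (@fdn C d n) d.
Proof.
case: d => [|[|d]] // _ n0.
(* The branch curve: where y ^+ (d - 1) = x ^+ n, the second component of
   fdn d n is (1 - d) x ^+ n y. *)
pose h : {poly {poly C}} :=
  'X%:P ^+ d.+1 + (- (- d.+1%:R) ^+ d.+1)%:P%:P * 'X ^+ (n * d.+2).
have hE z : eval2 h z = z.2 ^+ d.+1 - (- d.+1%:R) ^+ d.+1 * z.1 ^+ (n * d.+2).
  by rewrite !eval2E mulNr.
exists h.
  (* At (0, 1) the x-term vanishes because n is positive. *)
  have : eval2 h (0, 1) != 0.
    by rewrite hE /= expr0n muln_eq0 (gtn_eqF n0) /= expr1n mulr0 subr0 oner_eq0.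
  by apply: contraNneq => ->; rewrite -!polyC0 eval2C.
move=> z; have [rs [rsE szrs]] := fiber_poly_roots n z (isT : 2 <= d.+2)%N.
rewrite (fdn_fiber rsE) hE => hz.
rewrite -[in `I_ _]szrs -(size_map (pair z.1)); apply: card_eq_uniq_seq.
rewrite map_inj_uniq => [|x y [//]].
rewrite -separable_prod_XsubC -rsE; apply: contraNT hz => nsep.
have [y] : exists y, root (gcdp (fiber_poly d.+2 n z) (fiber_poly d.+2 n z)^`()) y.
  by apply/closed_rootP; move: nsep; rewrite unlock.
rewrite root_gcd !rootE fiber_poly_horner => /andP[/eqP y_fiber].
rewrite !derivD !derivN derivXn derivZ derivX derivC subr0 -mulr_natl -polyC_natr.
rewrite -mul_polyC mulr1 hornerD hornerN hornerM !hornerC hornerXn /=.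
rewrite -mulrBr mulf_eq0 pnatr_eq0 subr_eq0 /= => /eqP y_crit.
have -> : z.2 = - d.+1%:R * y ^+ d.+1 * y.
  apply/eqP; rewrite -subr_eq0 -oppr_eq0 -[X in _ == X]y_fiber -y_crit.
  by apply/eqP; rewrite !exprS; ring.
by rewrite exprM -y_crit [X in _ - _ * X]exprSr !exprMn mulrA subrr.
Qed.

Lemma avoid_finite_slice A a (rs : seq C) :
  closed A -> (forall r, r \in rs -> ~ A (a, r)) ->
  exists2 e : C, 0 < e & forall r x y, r \in rs ->
    `|a - x| < e -> `|r - y| < e -> ~ A (x, y).
Proof.
move=> Acl; elim: rs => [_|r rs IH out]; first by exists 1.
have [|e e0 eP] := IH; first by move=> s srs; apply: out; rewrite inE srs orbT.
have /nbhs_ballP[e' /= e'0 e'P] : nbhs (a, r) (~` A).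
  apply: open_nbhs_nbhs; split; first exact: closed_openC.
  exact/out/mem_head.
(* The order on [C] is partial, but positive elements are real, hence comparable. *)
have [m m0 [me me']] : exists2 m : C, 0 < m & m <= e /\ m <= e'.
  by case: (real_leP (gtr0_real e0) (gtr0_real e'0)) => le; [exists e|exists e'] => //;
    split=> //; exact: ltW.
exists m => // s x y; rewrite inE => /orP[/eqP -> ax ry|srs ax sy].
  apply: e'P; split => /=; rewrite -ball_normE /=.
    exact: lt_le_trans me'.
  exact: lt_le_trans me'.
apply: (eP s) => //; exact: lt_le_trans me.
Qed.

Lemma expr_le_norm_prod (rs : seq C) y (e : C) :
  0 <= e -> (forall q, q \in rs -> e <= `|y - q|) ->
  e ^+ size rs <= `|(\prod_(q <- rs) ('X - q%:P)).[y]|.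
Proof.
move=> e0; elim: rs => [|q rs IH] far; first by rewrite big_nil hornerC normr1.
rewrite big_cons hornerM hornerXsubC normrM exprS ler_pM ?exprn_ge0 //.
  by rewrite far ?mem_head.
by apply: IH => s srs; rewrite far // inE srs orbT.
Qed.

Lemma fdn_closed_map d n A : (2 <= d)%N -> closed A -> closed (@fdn C d n @` A).
Proof.
move=> d2 Acl w wcl; apply: contrapT => nAw.
have [rs [rsE szrs]] := fiber_poly_roots n w d2.
have [r rrs ar|e e0 eP] := @avoid_finite_slice A w.1 rs Acl.
  apply: nAw; exists (w.1, r) => //.
  have : (fdn d n @^-1` [set w]) (w.1, r) by rewrite (fdn_fiber rsE) /= map_f.
  by [].
case: rs rsE szrs eP => [_ d0|r rs rsE _ eP]; first by move: d2; rewrite -d0.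
(* [m] and [del] are chosen so that (e / m) (|r| + t + 1) <= t whenever t >= e; this is applied to t
   = |y - r|. *)
pose m := e + (`|r| + 1).
have m0 : 0 < m by rewrite addr_gt0 // ltr_wpDl.
pose del := e ^+ size rs * (e / m).
have del0 : 0 < del by rewrite mulr_gt0 ?exprn_gt0 ?divr_gt0.
have cvg1 : (fun z : C * C => z.1) @ w --> w.1 by exact: cvg_fst.
have cvg2 : (fun z : C * C => z.2) @ w --> w.2 by exact: cvg_snd.
have cvgn : (fun z : C * C => d%:R * z.1 ^+ n) @ w --> d%:R * w.1 ^+ n.
  apply: cvgM; first exact: cvg_cst.
  elim: (n) => [|k IH]; first exact: cvg_cst.
  under eq_fun do rewrite exprS.
  by rewrite exprS; exact: cvgM.
have near1 : \forall z \near w, `|w.1 - z.1| < e by exact: cvgr_dist_lt cvg1 _ e0.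
have near2 : \forall z \near w, `|w.2 - z.2| < del by exact: cvgr_dist_lt cvg2 _ del0.
have nearn : \forall z \near w, `|d%:R * w.1 ^+ n - d%:R * z.1 ^+ n| < del.
  exact: cvgr_dist_lt cvgn _ del0.
have [_ [[[x y] Axy <-] [[/= near1' near2'] nearn']]] :=
  wcl _ (filterI (filterI near1 near2) nearn).
have far q : q \in r :: rs -> e <= `|y - q|.
  move=> qrs; rewrite (real_leNgt (gtr0_real e0) (normr_real _)); apply/negP => qy.
  by apply: (eP q x y) => //; rewrite distrC.
(* The factor |y - r| is kept, to compete with the growth of |y|; each other factor is at least
   [e]. *)
have fiber_ge : e ^+ size rs * `|y - r| <= `|(fiber_poly d n w).[y]|.
  rewrite rsE big_cons hornerM hornerXsubC normrM mulrC ler_wpM2l //.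
  apply: expr_le_norm_prod => [|s srs]; first exact: ltW.
  by apply: far; rewrite inE srs orbT.
have fiber_lt : `|(fiber_poly d n w).[y]| < del * (`|r| + `|y - r| + 1).
  (* The fibre polynomial over the image of (x, y) vanishes at [y], so only differences of
     coefficients remain. *)
  have -> : (fiber_poly d n w).[y] = (y ^+ d - d%:R * x ^+ n * y - w.2) -
      (d%:R * w.1 ^+ n - d%:R * x ^+ n) * y by rewrite fiber_poly_horner; ring.
  rewrite mulrDr mulr1; apply: (le_lt_trans (ler_normB _ _)).
  rewrite addrC distrC ler_ltD // normrM; apply: ler_pM => //; first exact: ltW.
  by rewrite -{1}(subrKC r y) ler_normD.
have := le_lt_trans fiber_ge fiber_lt; rewrite /del -mulrA ltr_pM2l ?exprn_gt0 //.
rewrite mulrAC ltr_pdivlMr // => /lt_geF/negP; apply.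
rewrite (_ : e * _ = `|y - r| * e + e * (`|r| + 1)); last by ring.
by rewrite [leRHS]mulrDr lerD2l ler_wpM2r ?addr_ge0 // far ?mem_head.
Qed.

Lemma fdn_proper d n : (2 <= d)%N -> proper_polynomial_map (@fdn C d n).
Proof.
move=> d2; split.
- exact: fdn_polynomial_map.
- exact: fdn_dominant.
- by move=> A; exact: fdn_closed_map.
- by move=> z; exact: fdn_fiber_compact.
Qed.

End FdnProper.

(** * Equivalence classes and their infinitude *)

Section Classification.
Variable C : numClosedFieldType.
Implicit Types f g : C * C -> C * C.

Lemma id_automorphism : polynomial_automorphism (@id (C * C)).
Proof.
have idP : polynomial_map (@id (C * C)).
  by exists 'X, 'X%:P => -[x y]; rewrite eval2X eval2Y.
by split=> //; exists id.
Qed.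

Lemma automorphism_inverse f : polynomial_automorphism f ->
  exists g, [/\ polynomial_automorphism g, cancel f g & cancel g f].
Proof. by move=> [fP [g gP [fK gK]]]; exists g; do ?split=> //; exists f. Qed.

Lemma equivalent_maps_refl f : proper_polynomial_map f -> equivalent_maps f f.
Proof.
move=> fP; split=> //; exists id, id.
by split=> //; exact: id_automorphism.
Qed.

Lemma equivalent_maps_sym f g : equivalent_maps f g -> equivalent_maps g f.
Proof.
move=> [fP gP [p [q [pA qA fgE]]]]; split=> //.
have [p' [p'A pK p'K]] := automorphism_inverse pA.
have [q' [q'A qK q'K]] := automorphism_inverse qA.
by exists p', q'; split=> //; apply/funext => z; rewrite fgE /= p'K qK.
Qed.

Lemma equivalent_fdn_le d m n : (3 <= d)%N -> (2 <= m)%N -> (2 <= n)%N ->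
  equivalent_maps (@fdn C d n) (@fdn C d m) -> (m <= n)%N.
Proof.
case: d m n => [|[|[|d]]] // [|[|m]] // [|[|n]] // _ _ _ [_ _ [f [g [fA gA fgE]]]].
exact: (exponent_le fA gA fgE).
Qed.

(** Symmetry of equivalence turns the one-sided bound into equality. *)
Lemma equivalent_fdn d m n : (3 <= d)%N -> (2 <= m)%N -> (2 <= n)%N ->
  (equivalent_maps (@fdn C d n) (@fdn C d m) <-> m = n).
Proof.
move=> d3 m2 n2; split=> [eqv|->]; last exact/equivalent_maps_refl/fdn_proper/ltnW.
apply/eqP; rewrite eqn_leq (equivalent_fdn_le d3 m2 n2 eqv).
exact: equivalent_fdn_le d3 n2 m2 (equivalent_maps_sym eqv).
Qed.

Lemma infinite_proper_classes d : (3 <= d)%N -> infinite_set (proper_classes C d).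
Proof.
move=> d3; pose cls n := equivalence_class (@fdn C d n.+2).
have cls_inj : injective cls.
  move=> m n mn; apply/succn_inj/succn_inj/(@equivalent_fdn d) => //.
  have : cls m (fdn d m.+2) by exact/equivalent_maps_refl/fdn_proper/ltnW.
  by rewrite mn.
(* The preimage of a finite set under the injection [cls] would be finite, yet it is all of the
   naturals. *)
move=> /(finite_preimage (f := cls) (fun _ _ _ _ => @cls_inj _ _)).
rewrite (_ : _ @^-1` _ = setT) => [/infinite_nat//|].
apply/seteqP; split=> // n _; exists (fdn d n.+2) => //; split.
  exact/fdn_proper/ltnW.
exact/fdn_topological_degree/ltn0Sn/ltnW.
Qed.

End Classification.

Theorem theoremB (R : realType) :
  (forall d m n : nat, (3 <= d)%N -> (2 <= m)%N -> (2 <= n)%N ->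
     (equivalent_maps (@fdn (Cplx R) d n) (@fdn (Cplx R) d m) <-> m = n)) /\
  (forall d : nat, (3 <= d)%N -> infinite_set (proper_classes (Cplx R) d)).
Proof. by split; [exact: equivalent_fdn|exact: infinite_proper_classes]. Qed.
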